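(* Let $X$ be a real Banach space, let $f:[a,b]\to X$, and suppose that $md(f,\cdot)$ is continuous at $x\in[a,b]$. Then there exists $\delta>0$ such that $\bigvee_s^t f=\int_s^t md(f,y)\,dy$ for all $s<t$ with $s,t\in[x-\delta,x+\delta]\cap[a,b]$.
   Context: For $f:[a,b]\to X$, the unilateral metric derivatives are $md_{\pm}(f,x)=\lim_{t\to0+}\frac{\|f(x\pm t)-f(x)\|}{t}$. If both exist and are equal (and finite), their common value is the metric derivative $md(f,x)$; at an endpoint of $[a,b]$ only the one-sided limit taken inside $[a,b]$ is used. ''$md(f,\cdot)$ is continuous at $x$'' means that $md(f,s)$ exists for all $s\in[a,b]$ in some neighbourhood of $x$ and $md(f,s)\to md(f,x)$ as $s\to x$, $s\in[a,b]$. $\bigvee_s^t f$ denotes the total variation of $f$ on $[s,t]$. *)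

(* Defs.v *)
From HB Require Import structures.
From mathcomp Require Import all_boot all_order all_algebra.
From mathcomp Require Import all_classical all_reals all_analysis.
Set Implicit Arguments.
Unset Strict Implicit.
Unset Printing Implicit Defensive.
Import Order.TTheory GRing.Theory Num.Theory.
Import numFieldNormedType.Exports.
Local Open Scope classical_set_scope.
Local Open Scope ring_scope.

(* A map [a, b] -> X is represented by a total f : R -> X; none of the
   definitions below depends on the values of f outside of [a, b]. *)
Section metric_derivative.
Context {R : realType} {X : normedModType R}.
Implicit Types (a b x l s t : R) (f : R -> X).

Definition is_md_right f x l : Prop :=
  `|f (x + t) - f x| / t @[t --> 0^'+] --> l.

Definition is_md_left f x l : Prop :=
  `|f (x - t) - f x| / t @[t --> 0^'+] --> l.

(* The guards drop the one-sided limit that would leave [a, b]. When a < b, at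
   least one of them is active at each x in [a, b], so that l is unique. *)
Definition is_md a b f x l : Prop :=
  [/\ x \in `[a, b], x < b -> is_md_right f x l & a < x -> is_md_left f x l].

(* 0 is a dummy value used where the metric derivative does not exist *)
Definition md a b f x : R := xget 0 [set l | is_md a b f x l].

Definition md_continuous_at a b f x : Prop :=
  (\forall s \near within `[a, b] (nbhs x), exists l, is_md a b f s l) /\
  md a b f s @[s --> within `[a, b] (nbhs x)] --> md a b f x.

(* numfun.variation and realfun.total_variation, for X-valued instead of
   real-valued functions *)
Definition vvariation s t f (p : seq R) : R :=
  let F := f \o nth t (s :: p) in
  \sum_(0 <= n < size p) `|F n.+1 - F n|.

Definition vtotal_variation s t f : \bar R :=
  ereal_sup [set (vvariation s t f p)%:E | p in itv_partition s t].

End metric_derivative.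

(* Main.v *)
Require Import Defs.
From HB Require Import structures.
From mathcomp Require Import all_boot all_order all_algebra.
From mathcomp Require Import all_classical all_reals all_analysis.
From mathcomp Require Import measurable_realfun lra.
Set Implicit Arguments.
Unset Strict Implicit.
Unset Printing Implicit Defensive.
Import Order.TTheory GRing.Theory Num.Theory.
Import numFieldNormedType.Exports.
Local Open Scope classical_set_scope.
Local Open Scope ring_scope.

(**
   Near x the metric derivative exists and stays below M := md x + 1, so a
   supremum argument shows that f is M-Lipschitz there; extend f from [s, t] to
   the line by the constants f s and f t. For every continuous w,
   int_s^t (w (y + h) - w y) / h dy tends to w t - w s as h -> 0+, and by
   dominated convergence int_s^t |f (y + h) - f y| / h dy tends to int_s^t md.
   Comparing the two integrands for w y = |f y - f s| gives
   |f t - f s| <= int_s^t md on every subinterval, hence variation <= integral;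
   comparing them for the variation function w y = V(f, [s, y]), which is
   Lipschitz and satisfies |f (y + h) - f y| <= w (y + h) - w y, gives the
   converse inequality.
*)

(** * Lipschitz bound from the metric derivative *)

(** The guards refer to [s, t] itself, so that the condition passes to subintervals. The strict
    inequality in [m y < M] leaves room for the difference quotients at y to be at most M for all
    small steps. *)
Definition has_md_lt {R : realType} {X : normedModType R} (f : R -> X)
    (m : R -> R) (M s t : R) : Prop :=
  forall y, s <= y <= t -> [/\ m y < M,
    y < t -> is_md_right f y (m y) & s < y -> is_md_left f y (m y)].

Lemma has_md_ltS (R : realType) (X : normedModType R) (f : R -> X)
    (m : R -> R) (M s t p q : R) :
  s <= p -> q <= t -> has_md_lt f m M s t -> has_md_lt f m M p q.
Proof.
move=> sp qt H y /andP[py yq].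
have [|mM Hr Hl] := H y; first by rewrite (le_trans sp)// (le_trans yq).
by split=> // [yq'|py']; [apply: Hr|apply: Hl]; lra.
Qed.

Lemma cvg_quotient_near_le (R : realType) (u : R -> R) (l M : R) :
  u h / h @[h --> 0^'+] --> l -> l < M ->
  exists2 e : R, 0 < e & forall h, 0 < h < e -> u h <= M * h.
Proof.
move=> ul lM.
have /= : \forall h \near 0^'+, u h / h < M by exact: (cvgr_lt l).
move=> [e /= e0 He]; exists e => // h /andP[h0 he].
rewrite -ler_pdivrMr//; apply/ltW/He => //=.
by rewrite sub0r normrN gtr0_norm.
Qed.

(** Let c be the supremum of the points y of [p, q] at which the bound holds between p and y. The
    left derivative at c carries the bound from nearby points to c itself; if c < q, the right
    derivative carries it beyond c, a contradiction. *)
Lemma has_md_lt_lipschitz (R : realType) (X : normedModType R) (f : R -> X)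
    (m : R -> R) (M s t : R) : has_md_lt f m M s t ->
  forall p q, s <= p -> p <= q -> q <= t -> `|f q - f p| <= M * (q - p).
Proof.
move=> H p q sp pq qt.
pose S := [set y | p <= y <= q /\ `|f y - f p| <= M * (y - p)].
have Sp : S p by split; rewrite ?lexx//= !subrr normr0 mulr0.
have hS : has_sup S by split; [exists p|exists q => y [/andP[]]].
set c := sup S.
have pc : p <= c by apply: ub_le_sup Sp => //; exact: hS.2.
have cq : c <= q by apply: ge_sup => [|y [/andP[]]//]; exact: hS.1.
have [|mM Hr Hl] := H c; first by rewrite (le_trans sp)//= (le_trans cq).
have trS y z : S y -> y <= z -> z <= q -> `|f z - f y| <= M * (z - y) -> S z.
  move=> [/andP[py yq] fyp] yz zq fzy; split; first by rewrite (le_trans py).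
  by have := ler_distD (f y) (f z) (f p); lra.
have Sc : S c.
  move: pc; rewrite le_eqVlt => /predU1P[<-//|pc].
  have [e e0 He] := cvg_quotient_near_le (Hl (le_lt_trans sp pc)) mM.
  have [y Sy cy] : exists2 y, S y & c - e < y by exact: sup_adherent.
  have yc : y <= c by apply: ub_le_sup Sy; exact: hS.2.
  apply: (trS y) => //; move: yc; rewrite le_eqVlt => /predU1P[->|yc].
    by rewrite !subrr normr0 mulr0.
  have := He (c - y); rewrite opprB addrCA subrr addr0 distrC; apply; lra.
move: cq; rewrite le_eqVlt => /predU1P[cq|cq]; first by rewrite -cq; case: Sc.
have [e e0 He] := cvg_quotient_near_le (Hr (lt_le_trans cq qt)) mM.
(* A positive step that is strictly below e and keeps c + h in [p, q]. *)
pose h := Num.min (e / 2) (q - c).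
have h0 : 0 < h by rewrite lt_min; apply/andP; split; lra.
have he : h <= e / 2 by rewrite ge_min lexx.
have hq : h <= q - c by rewrite ge_min lexx orbT.
have : S (c + h).
  apply: (trS c) => //; try lra.
  by rewrite (_ : c + h - c = h) ?He//; lra.
by move/(ub_le_sup hS.2); rewrite -/c; lra.
Qed.

(** * Constant extension outside an interval *)

(** The nearest-point retraction of the line onto [s, t] when s <= t; [f \o clamp s t] extends f by
    its endpoint values. *)
Definition clamp {R : realType} (s t y : R) : R := Num.max s (Num.min t y).

Lemma clamp_itv (R : realType) (s t y : R) : s <= t -> s <= clamp s t y <= t.
Proof. by move=> st; rewrite le_max lexx ge_max st ge_min lexx. Qed.

Lemma clamp_id (R : realType) (s t y : R) : s <= y <= t -> clamp s t y = y.
Proof. by move=> /andP[sy yt]; rewrite /clamp min_r// max_r. Qed.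

Lemma clamp_left (R : realType) (s t : R) : s <= t -> clamp s t s = s.
Proof. by move=> st; rewrite clamp_id ?lexx. Qed.

Lemma clamp_right (R : realType) (s t : R) : s <= t -> clamp s t t = t.
Proof. by move=> st; rewrite clamp_id ?lexx ?andbT. Qed.

Lemma le_clamp (R : realType) (s t y z : R) :
  y <= z -> clamp s t y <= clamp s t z.
Proof. by move=> yz; rewrite le_max2// le_min2. Qed.

Lemma clamp_dist (R : realType) (s t y z : R) :
  y <= z -> clamp s t z - clamp s t y <= z - y.
Proof. by move=> yz; rewrite /clamp /Num.max /Num.min; do !case: ifPn; lra. Qed.

Lemma clamp_lipschitz_continuous (R : realType) (X : normedModType R)
    (f : R -> X) (M s t : R) : s <= t -> 0 <= M ->
  (forall p q, s <= p -> p <= q -> q <= t -> `|f q - f p| <= M * (q - p)) ->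
  continuous (f \o clamp s t).
Proof.
move=> st M0 lf.
(* M may be 0; M + 1 is positive and can be inverted to choose the radius below. *)
have F y z : `|f (clamp s t y) - f (clamp s t z)| <= (M + 1) * `|y - z|.
  wlog zy : y z / z <= y => [hw|].
    have [|/ltW] := leP z y; first exact: hw.
    by rewrite distrC (distrC y); exact: hw.
  have /andP[sz zt] := clamp_itv z st; have /andP[sy yt] := clamp_itv y st.
  apply: le_trans (lf _ _ sz (le_clamp _ _ zy) yt) _.
  rewrite (ger0_norm (_ : 0 <= y - z)) ?subr_ge0//.
  have := clamp_dist s t zy; have := le_clamp s t zy; nra.
move=> y; apply/cvgrPdist_lt => e e0; exists ((M + 1)^-1 * e) => /= [|z yz].
  by rewrite mulr_gt0// invr_gt0; lra.
by rewrite (le_lt_trans (F _ _))// -ltr_pdivlMl//; lra.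
Qed.

(** * Variation of a Lipschitz map *)

Lemma vvariation_cons (R : realType) (X : normedModType R) (f : R -> X)
    (s t z : R) (p : seq R) :
  vvariation s t f (z :: p) = `|f z - f s| + vvariation z t f p.
Proof. by rewrite /vvariation /= big_nat_recl. Qed.

Lemma vvariation_nil (R : realType) (X : normedModType R) (f : R -> X)
    (s t : R) : vvariation s t f [::] = 0.
Proof. by rewrite /vvariation big_geq. Qed.

(** The endpoint argument enters [vvariation] only as the default of [nth], and all indices are in
    range; hence it may change when a partition is extended to a new endpoint. *)
Lemma vvariation_rcons (R : realType) (X : normedModType R) (f : R -> X)
    (s t t' z : R) (p : seq R) :
  vvariation s t f (rcons p z) = vvariation s t' f p + `|f z - f (last s p)|.
Proof.
elim: p s => [|y p ih] s /=.
  by rewrite vvariation_cons !vvariation_nil addrC.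
by rewrite !vvariation_cons ih addrA.
Qed.

Section variation_lipschitz.
Context {R : realType} {X : normedModType R} (f : R -> X) (M s t : R).
Hypothesis lf :
  forall p q, s <= p -> p <= q -> q <= t -> `|f q - f p| <= M * (q - p).

Lemma vvariation_le y z p : s <= y -> z <= t -> itv_partition y z p ->
  vvariation y z f p <= M * (z - y).
Proof.
move=> sy zt; elim: p y sy => [|u p ih] y sy.
  by move=> /itv_partition_nil ->; rewrite vvariation_nil subrr mulr0.
move=> /[dup] /itv_partition_cons up [/= /andP[yu _] _].
have uz := itv_partition_le up.
rewrite vvariation_cons.
have := ih u (le_trans sy (ltW yu)) up.
by have := lf sy (ltW yu) (le_trans uz zt); lra.
Qed.

(* The points of the partition beyond y contribute at most the Lipschitz bound
   on [y, z]. *)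
Lemma vvariation_truncate u y z p : s <= u -> u <= y -> y <= z -> z <= t ->
  itv_partition u z p -> exists2 q, itv_partition u y q &
    vvariation u z f p <= vvariation u y f q + M * (z - y).
Proof.
move=> + + yz zt; elim: p u => [|c p ih] u su uy.
  move=> /itv_partition_nil uz; have -> : u = y by lra.
  exists [::]; first by split.
  have -> : z = y by lra.
  by rewrite !vvariation_nil subrr mulr0 addr0.
move=> up; have [/= /andP[uc _] _] := up.
have {}up := itv_partition_cons up; have cz := itv_partition_le up.
rewrite vvariation_cons; have [cy|yc] := leP c y.
  have [q qP qle] := ih c (le_trans su (ltW uc)) cy up.
  exists (c :: q); first by case: qP => ? ?; split => //=; rewrite uc.
  by rewrite vvariation_cons; lra.
have sy := le_trans su uy.
have pM : vvariation c z f p <= M * (z - c).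
  by apply: vvariation_le => //; lra.
have cM := lf sy (ltW yc) (le_trans cz zt).
move: uy; rewrite le_eqVlt => /predU1P[uy|uy].
  exists [::]; first by rewrite uy; split.
  by rewrite vvariation_nil uy; lra.
exists [:: y]; first exact: itv_partition1.
rewrite vvariation_cons vvariation_nil.
by have := ler_distD (f y) (f c) (f u); lra.
Qed.

Lemma vvariation_sup y p : itv_partition s y p ->
  ((vvariation s y f p)%:E <= vtotal_variation s y f)%E.
Proof. by move=> sp; apply: ereal_sup_ubound; exists p. Qed.

Lemma vtotal_variation_ge0 y : s <= y -> (0 <= vtotal_variation s y f)%E.
Proof.
rewrite le_eqVlt => /predU1P[<-|sy].
  by have := @vvariation_sup s [::]; rewrite vvariation_nil; apply; split.
apply: le_trans (vvariation_sup (itv_partition1 sy)).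
by rewrite vvariation_cons vvariation_nil addr0 lee_fin.
Qed.

Lemma vtotal_variation_fin_num y : s <= y -> y <= t ->
  vtotal_variation s y f \is a fin_num.
Proof.
move=> sy yt; rewrite ge0_fin_numE ?vtotal_variation_ge0//.
apply: (@le_lt_trans _ _ (M * (y - s))%:E); last exact: ltry.
by apply: ge_ereal_sup => _ [p sp <-]; rewrite lee_fin vvariation_le.
Qed.

(** Appending z to a partition of [s, y] adds exactly the term [|f z - f y|]. *)
Lemma vtotal_variation_superadditive y z : s <= y -> y < z -> z <= t ->
  (vtotal_variation s y f + `|f z - f y|%:E <= vtotal_variation s z f)%E.
Proof.
move=> sy yz zt; rewrite -leeBrDr//.
apply: ge_ereal_sup => _ [p sp <-]; rewrite leeBrDr// -EFinD.
have -> : `|f z - f y| = `|f z - f (last s p)| by case: sp => _ /eqP ->.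
rewrite -(@vvariation_rcons _ _ _ _ z); apply: vvariation_sup.
rewrite -cats1; apply: itv_partition_cat sp _; exact: itv_partition1.
Qed.

(** Stands in for additivity of the variation: cutting each partition of [s, z] at y loses at most
    the Lipschitz bound on [y, z]. This makes the variation function Lipschitz. *)
Lemma vtotal_variation_le_add y z : s <= y -> y <= z -> z <= t ->
  (vtotal_variation s z f <= vtotal_variation s y f + (M * (z - y))%:E)%E.
Proof.
move=> sy yz zt; apply: ge_ereal_sup => _ [p sp <-].
have [q qP] := vvariation_truncate (lexx s) sy yz zt sp.
rewrite -lee_fin EFinD => /le_trans; apply.
by rewrite leeD2r// vvariation_sup.
Qed.

Let v y := fine (vtotal_variation s y f).

Lemma variation_function_le y z : s <= y -> y <= z -> z <= t ->
  `|f z - f y| <= v z - v y.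
Proof.
move=> sy; rewrite le_eqVlt => /predU1P[->|yz] zt; first by rewrite !subrr normr0.
have := vtotal_variation_superadditive sy yz zt.
rewrite -(fineK (vtotal_variation_fin_num sy _)); last lra.
rewrite -(fineK (vtotal_variation_fin_num _ zt)); last lra.
by rewrite -EFinD lee_fin -/(v y) -/(v z); lra.
Qed.

Lemma variation_function_lipschitz y z : s <= y -> y <= z -> z <= t ->
  `|v z - v y| <= M * (z - y).
Proof.
move=> sy yz zt.
rewrite ger0_norm ?(le_trans _ (variation_function_le sy yz zt))//.
have := vtotal_variation_le_add sy yz zt.
rewrite -(fineK (vtotal_variation_fin_num sy _)); last lra.
rewrite -(fineK (vtotal_variation_fin_num _ zt)); last lra.
by rewrite -EFinD lee_fin -/(v y) -/(v z); lra.
Qed.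

End variation_lipschitz.

(** * Limits of integrated difference quotients *)

Lemma shift_difference_continuous (R : realType) (X : normedModType R)
    (F : R -> X) (h : R) :
  continuous F -> continuous (fun y => F (y + h) - F y).
Proof.
move=> cF y; apply: cvgB; last exact: cF.
apply: (@continuous_comp _ _ _ (fun y => y + h) F); last exact: cF.
by apply: cvgD; [exact: cvg_id|exact: cvg_cst].
Qed.

Lemma continuous_integrable_itv (R : realType) (u : R -> R) (s t : R) :
  continuous u -> lebesgue_measure.-integrable `[s, t] (EFin \o u).
Proof.
move=> cu; apply: continuous_compact_integrable; first exact: segment_compact.
exact: continuous_subspaceT.
Qed.

Lemma continuous_antiderivative (R : realType) (w : R -> R) (A B : R) :
  continuous w -> exists W : R -> R,
    forall y, A < y < B -> is_derive y 1 W (w y).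
Proof.
move=> cw; pose mu := @lebesgue_measure R.
exists (fun y => (\int[mu]_(z in `[A, y]) w z)%R) => y /andP[Ay yB].
have iw : mu.-integrable `[A, B] (EFin \o w) by exact: continuous_integrable_itv.
have [] := @continuous_FTC1_closed R w A y B yB iw Ay (cw y).
by move=> dW; rewrite derive1E => <-; exact: DeriveDef.
Qed.

(** Replaces h -> 0+ by the steps 1 / (n + 1), since dominated convergence is applied to a
    sequence. *)
Lemma cvg_harmonic_at_right (R : realType) (g : R -> R) (l : R) :
  g h @[h --> 0^'+] --> l -> g (harmonic n) @[n --> \oo] --> l.
Proof.
move=> /cvg_at_rightP; apply; split; first exact: harmonic_gt0.
exact: cvg_harmonic.
Qed.

(** If W' = w, then y |-> (W (y + h) - W y) / h is an antiderivative of the integrand. The integral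
    is thus the difference of the quotients of W at t and at s, which tend to w t and w s. *)
Lemma integral_difference_quotient_cvg (R : realType) (w : R -> R) (s t : R) :
  s < t -> continuous w ->
  (\int[lebesgue_measure]_(y in `[s, t])
    ((w (y + harmonic n) - w y) / harmonic n))%R @[n --> \oo] --> w t - w s.
Proof.
move=> st cw.
(* The steps are at most 1, so y + h stays in this window for every y in (s - 1, t + 1), a
   neighbourhood of [s, t]. *)
have [W dW] := continuous_antiderivative (s - 1) (t + 2) cw.
have Dquo y : s <= y <= t ->
    (W (y + harmonic n) - W y) / harmonic n @[n --> \oo] --> w y.
  move=> /andP[sy yt].
  have dy : is_derive y 1 W (w y) by apply: dW; lra.
  have /cvg_dnbhs_at_right/cvg_harmonic_at_right :=
    @ex_derive _ _ _ _ _ _ _ dy.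
  (* Derivability is convergence to the limit of the quotients, which is ['D_1 W y] by
     definition. *)
  rewrite -[X in _ --> X -> _]/('D_1 W y) derive_val.
  apply: cvg_trans; apply: near_eq_cvg; apply: nearW => n /=.
  rewrite /GRing.scale/= mulr1.
  by rewrite mulrC [y + _]addrC.
rewrite (_ : (fun n => _) = fun n =>
    (W (t + harmonic n) - W t) / harmonic n -
    (W (s + harmonic n) - W s) / harmonic n); last first.
  apply/funext => n; set h := harmonic n.
  have h0 : 0 < h := harmonic_gt0 n.
  have h1 : h <= 1 by rewrite /h /= invf_le1// ler1n.
  have cwh : continuous (fun y => (w (y + h) - w y) / h).
    by move=> y; apply: cvgMl; exact: shift_difference_continuous.
  pose G y := h^-1 * (W (y + h) - W y).
  have dG y : s - 1 < y < t + 1 -> is_derive y 1 G ((w (y + h) - w y) / h).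
    move=> sty.
    have d1 : is_derive y 1 W (w y) by apply: dW; lra.
    have d2 : is_derive (y + h) 1 W (w (y + h)) by apply: dW; lra.
    have d3 := is_derive_shift y 1 h.
    have d4 : is_derive y 1 (W \o shift h) (w (y + h) *: 1).
      exact: is_derive1_comp.
    apply: is_derive_eq (is_deriveZ (h^-1) (is_deriveB d4 d1)) _.
    by rewrite /GRing.scale/= mulr1 mulrC.
  have cG y : s - 1 < y < t + 1 -> {for y, continuous G}.
    move=> sty; apply/differentiable_continuous/derivable1_diffP.
    by have [] := dG y sty.
  rewrite /Rintegral (@continuous_FTC2 _ _ G)//=.
  - by rewrite /G !(mulrC h^-1).
  - exact: continuous_subspaceT.
  - split => [y|/=|/=].
    + rewrite in_itv/= => ?; suff /dG[] : s - 1 < y < t + 1 by []; lra.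
    + apply: cvg_at_right_filter; apply: cG; lra.
    + apply: cvg_at_left_filter; apply: cG; lra.
  - move=> y; rewrite in_itv/= => ?; rewrite derive1E.
    suff /dG[] : s - 1 < y < t + 1 by []; lra.
by apply: cvgB; apply: Dquo; lra.
Qed.

Lemma has_md_lt_ge0 (R : realType) (X : normedModType R) (f : R -> X)
    (m : R -> R) (M s t : R) : s < t -> has_md_lt f m M s t -> 0 <= M.
Proof.
move=> st H; rewrite -(pmulr_lge0 _ (_ : 0 < t - s)) ?subr_gt0//.
apply: le_trans (normr_ge0 _) _.
exact: has_md_lt_lipschitz H _ _ (lexx s) (ltW st) (lexx t).
Qed.

Lemma has_md_lt_continuous (R : realType) (X : normedModType R) (f : R -> X)
    (m : R -> R) (M s t : R) : s < t -> has_md_lt f m M s t ->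
  continuous (f \o clamp s t).
Proof.
move=> st H; apply: clamp_lipschitz_continuous (has_md_lt_ge0 st H) _.
  exact: ltW.
exact: has_md_lt_lipschitz H.
Qed.

(** The quotients are bounded by M, because f is M-Lipschitz on [s, t] and [clamp] does not increase
    distances. They converge to m on [s, t) by the right derivative, so dominated convergence
    applies. *)
Lemma has_md_lt_integral_cvg (R : realType) (X : normedModType R) (f : R -> X)
    (m : R -> R) (M s t : R) (h := @harmonic R) (F := f \o clamp s t) :
  s < t -> has_md_lt f m M s t ->
  lebesgue_measure.-integrable `[s, t] (EFin \o m) /\
  (\int[lebesgue_measure]_(y in `[s, t])
    (`|F (y + h n) - F y| / h n))%R @[n --> \oo] -->
  (\int[lebesgue_measure]_(y in `[s, t]) m y)%R.
Proof.
move=> st H; have lf := has_md_lt_lipschitz H.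
have M0 := has_md_lt_ge0 st H; have cF := has_md_lt_continuous st H.
pose mu := @lebesgue_measure R.
pose u n y := `|F (y + h n) - F y| / h n.
have h0 n : 0 < h n := harmonic_gt0 n.
have mu_ n (D : set R) : measurable_fun D (u n).
  apply: measurable_funTS; apply: continuous_measurable_fun => y.
  by apply: cvgMl; apply: cvg_norm; exact: shift_difference_continuous.
have uM n y : `|u n y| <= M.
  rewrite ger0_norm ?divr_ge0//; last exact: ltW.
  rewrite ler_pdivrMr//.
  have yh : y <= y + h n by rewrite lerDl ltW.
  have /andP[sy _] := clamp_itv y (ltW st).
  have /andP[_ yt] := clamp_itv (y + h n) (ltW st).
  apply: le_trans (lf _ _ sy (le_clamp _ _ yh) yt) _.
  by rewrite ler_wpM2l// (le_trans (clamp_dist s t yh))// addrC addKr.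
have um y : s <= y < t -> u ^~ y @ \oo --> m y.
  move=> /andP[sy yt].
  have [|_ /(_ yt)/cvg_harmonic_at_right + _] := H y; first by rewrite sy ltW.
  apply: cvg_trans; apply: near_eq_cvg.
  (* For such n both y and y + h n lie in [s, t], where [clamp] is the identity. *)
  have : \forall n \near \oo, harmonic n < t - y.
    by apply: (cvgr_lt 0 cvg_harmonic); rewrite subr_gt0.
  apply: filterS => n nt; have := h0 n.
  rewrite /h => hn; rewrite /u /F /= !clamp_id//; first by rewrite sy ltW.
  by apply/andP; split; [apply: le_trans sy _; rewrite lerDl ltW|rewrite -lerBrDl ltW].
(* m is a pointwise limit of measurable functions on [s, t); adding the endpoint preserves
   measurability. *)
have mm : measurable_fun `[s, t] m.
  apply/measurable_fun_itv_bndo_bndcP; apply: measurable_fun_cvg => [n|y].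
    exact: mu_ n _.
  by rewrite /= in_itv/=; exact: um.
have [] := @dominated_convergence _ _ R mu `[s, t] (measurable_itv _)
    (fun n => EFin \o u n) (EFin \o m) (EFin \o cst M).
- by move=> n; apply/measurable_EFinP; exact: mu_.
- exact/measurable_EFinP.
(* At t the extension is constant to the right, so its quotients vanish there and need not tend to m
   t. *)
- exists [set t]; split; [exact: measurable_set1|exact: lebesgue_measure_set1|].
  move=> y /= /not_implyP[]; rewrite in_itv/= => /andP[sy yt].
  apply: contra_notP => /eqP ty; apply: cvg_EFin; first exact: nearW.
  by apply: um; rewrite sy lt_neqAle ty yt.
- by apply: continuous_integrable_itv => y; exact: cvg_cst.
- apply: aeW => y n _; rewrite /= lee_fin; exact: uM.
move=> im _ ucvg; split => //.
rewrite -(fineK (integrable_fin_num _ im))// in ucvg.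
exact: fine_cvg ucvg.
Qed.

(** * Comparison of variation and integral *)

Lemma has_md_lt_dist_le (R : realType) (X : normedModType R) (f : R -> X)
    (m : R -> R) (M s t : R) : s < t -> has_md_lt f m M s t ->
  `|f t - f s| <= (\int[lebesgue_measure]_(y in `[s, t]) m y)%R.
Proof.
move=> st H; have [_ ucvg] := has_md_lt_integral_cvg st H.
have cF := has_md_lt_continuous st H.
set F := f \o clamp s t in ucvg cF.
pose w y := `|F y - F s|.
have cw : continuous w.
  by move=> y; apply: cvg_norm; apply: cvgB; [exact: cF|exact: cvg_cst].
suff : w t - w s <= (\int[lebesgue_measure]_(y in `[s, t]) m y)%R.
  rewrite /w /F /= clamp_left ?clamp_right; try exact: ltW.
  by rewrite subrr normr0 subr0.
apply: (ler_cvg_to (integral_difference_quotient_cvg st cw) ucvg).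
apply: nearW => n; apply: le_Rintegral; first exact: measurable_itv.
- apply: continuous_integrable_itv => y.
  by apply: cvgMl; exact: shift_difference_continuous.
- apply: continuous_integrable_itv => y.
  by apply: cvgMl; apply: cvg_norm; exact: shift_difference_continuous.
move=> y _; rewrite ler_pM2r ?invr_gt0 ?harmonic_gt0// /w.
by rewrite lerBlDr; exact: ler_distD.
Qed.

Lemma has_md_lt_integral_le (R : realType) (X : normedModType R) (f : R -> X)
    (m : R -> R) (M s t : R) : s < t -> has_md_lt f m M s t ->
  ((\int[lebesgue_measure]_(y in `[s, t]) m y)%R%:E <=
    vtotal_variation s t f)%E.
Proof.
move=> st H; have [_ ucvg] := has_md_lt_integral_cvg st H.
have cF := has_md_lt_continuous st H.
have lf := has_md_lt_lipschitz H.
pose v y := fine (vtotal_variation s y f).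
have vle := @variation_function_le _ _ _ _ _ _ lf.
have cw : continuous (v \o clamp s t).
  apply: (clamp_lipschitz_continuous (ltW st) (has_md_lt_ge0 st H)).
  by move=> p q; exact: variation_function_lipschitz.
rewrite -(fineK (vtotal_variation_fin_num lf (ltW st) (lexx t))) lee_fin.
(* As v s is nonnegative, v t - v s is at most the variation on [s, t]. *)
apply: (@le_trans _ _ ((v \o clamp s t) t - (v \o clamp s t) s)); last first.
  rewrite /= clamp_left ?clamp_right; try exact: ltW.
  rewrite lerBlDr lerDl.
  exact/fine_ge0/vtotal_variation_ge0.
apply: (ler_cvg_to ucvg (integral_difference_quotient_cvg st cw)).
apply: nearW => n; apply: le_Rintegral; first exact: measurable_itv.
- apply: continuous_integrable_itv => y.
  by apply: cvgMl; apply: cvg_norm; exact: shift_difference_continuous.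
- apply: continuous_integrable_itv => y.
  by apply: cvgMl; exact: shift_difference_continuous.
move=> y _; rewrite ler_pM2r ?invr_gt0 ?harmonic_gt0//.
have /andP[sy _] := clamp_itv y (ltW st).
have /andP[_ yt] := clamp_itv (y + harmonic n) (ltW st).
by apply: vle => //; apply: le_clamp; rewrite lerDl ltW ?harmonic_gt0.
Qed.

Lemma has_md_lt_vvariation_le (R : realType) (X : normedModType R)
    (f : R -> X) (m : R -> R) (M s t : R) (p : seq R) :
  s < t -> has_md_lt f m M s t -> itv_partition s t p ->
  vvariation s t f p <= (\int[lebesgue_measure]_(y in `[s, t]) m y)%R.
Proof.
elim: p s => [|z p ih] s st H.
  by move=> /itv_partition_nil ts; rewrite ts ltxx in st.
move=> /[dup] /itv_partition_cons zp [/= /andP[sz _] _].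
have zt := itv_partition_le zp; rewrite vvariation_cons.
have szm := has_md_lt_dist_le sz (has_md_ltS (lexx s) zt H).
(* Partitions increase strictly, so z = t leaves only the empty tail; the induction hypothesis
   covers z < t. *)
move: zt; rewrite le_eqVlt => /predU1P[zt|zt].
  move: zp szm; rewrite zt => /itv_partitionxx ->.
  by rewrite vvariation_nil addr0.
have ztm := ih z zt (has_md_ltS (ltW sz) (lexx t) H) zp.
have [im _] := has_md_lt_integral_cvg st H.
have := Rintegral_itvB im (x := z); rewrite !bnd_simp => /(_ (ltW sz) (ltW zt)).
rewrite Rintegral_itv_obnd_cbnd; last first.
  apply: integrableS im => //; apply: subset_itvr; rewrite bnd_simp; exact: ltW.
lra.
Qed.

Lemma has_md_lt_vtotal_variation (R : realType) (X : normedModType R)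
    (f : R -> X) (m : R -> R) (M s t : R) : s < t -> has_md_lt f m M s t ->
  lebesgue_measure.-integrable `[s, t] (fun y => (m y)%:E) /\
  vtotal_variation s t f =
    (\int[lebesgue_measure]_(y in `[s, t]) (m y)%:E)%E.
Proof.
move=> st H; have [im _] := has_md_lt_integral_cvg st H; split => //.
rewrite -(fineK (integrable_fin_num _ im))//.
apply/eqP; rewrite eq_le; apply/andP; split; last exact: has_md_lt_integral_le H.
apply: ge_ereal_sup => _ [p sp <-]; rewrite lee_fin.
exact: has_md_lt_vvariation_le H sp.
Qed.

(** * Localisation at a point of continuity *)

Theorem lemma4p2 (R : realType) (X : completeNormedModType R) (a b : R)
    (f : R -> X) (x : R) (xab : x \in `[a, b])
    (mdx : md_continuous_at a b f x) :
  exists2 delta : R, 0 < delta &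
    forall s t : R, s < t ->
      s \in `[x - delta, x + delta] -> s \in `[a, b] ->
      t \in `[x - delta, x + delta] -> t \in `[a, b] ->
      lebesgue_measure.-integrable `[s, t] (fun y => (md a b f y)%:E) /\
      vtotal_variation s t f =
        (\int[lebesgue_measure]_(y in `[s, t]) (md a b f y)%:E)%E.
Proof.
case: mdx => mdex mdcvg.
have mdlt : \forall y \near within `[a, b] (nbhs x),
    md a b f y < md a b f x + 1.
  by apply: (cvgr_lt _ mdcvg); rewrite ltrDl.
have [e /= e0 He] := filterI mdex mdlt.
(* Half the radius places the closed interval inside the open ball of radius e. *)
exists (e / 2); first lra.
move=> s t st; rewrite !in_itv/= => /andP[xs _] /andP[sa _] /andP[_ tx] /andP[_ tb].
apply: (@has_md_lt_vtotal_variation _ _ _ _ (md a b f x + 1) _ _ st).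
move=> y /andP[sy yt].
have [||[l yl] ymd] := He y.
- by rewrite /= ltr_norml; lra.
- by rewrite /= in_itv/=; lra.
(* Since some l is a metric derivative at y, [xget] returns one and not the dummy 0. *)
have [_ yr yleft] : is_md a b f y (md a b f y) by exact: xgetI yl.
by split=> // [yt'|sy']; [apply: yr|apply: yleft]; lra.
Qed.
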